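(* Let $S$ be any set with $\bot \notin S$, and let $\mathcal{P}_\star(S) = \{ X \subseteq S \cup \{\bot\} \mid X \text{ infinite} \Rightarrow \bot \in X \}$. Define a relation $\sqsubseteq$ on $\mathcal{P}_\star(S)$ by $$X \sqsubseteq Y \iff X = Y \ \lor\ \big(\bot \in X \land (Y = \emptyset \lor X \setminus \{\bot\} \subseteq Y)\big).$$ Then $(\mathcal{P}_\star(S), \sqsubseteq)$ is an $\omega$-complete partial order with a least element (i.e., $\sqsubseteq$ is a partial order, there is a least element, and every increasing sequence $X_0 \sqsubseteq X_1 \sqsubseteq X_2 \sqsubseteq \cdots$ has a supremum).
   Context: $\bot$ is a fresh symbol representing non-termination. An element $X \in \mathcal{P}_\star(S)$ represents the set of outcomes of a nondeterministic computation: $X=\emptyset$ is the error value, $\bot\in X$ means some branch diverges, and the other elements of $X$ are returned values. *)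

(* Defs.v *)
(* S ∪ {⊥} is modelled as [option S] with [None] = ⊥
   (so ⊥ ∉ S automatically); subsets are predicates [option S -> Prop],
   compared with Leibniz equality (extensionality axioms are whitelisted). *)
From Stdlib Require Import List.

Definition oset (S : Type) := option S -> Prop.

Definition is_finite {S : Type} (X : oset S) : Prop :=
  exists l : list (option S), forall x, X x -> In x l.

Definition Pstar {S : Type} (X : oset S) : Prop :=
  ~ is_finite X -> X None.

Definition sqle {S : Type} (X Y : oset S) : Prop :=
  X = Y \/
  (X None /\ ((forall y, ~ Y y) \/ (forall x, X x -> x <> None -> Y x))).

(* Main.v *)
(* A set without bottom is below nothing but itself, so an increasing chain either
   reaches a bottom-free set, after which it is constant and that set is its supremum,
   or consists of sets that all contain bottom; then the union is the supremum, because
   every upper bound is either one of the chain's sets, or the error value, or a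
   superset of all the returned values.  Sets containing bottom belong to P_*(S), so
   the supremum stays inside P_*(S); the least element is the singleton {bottom}. *)
Require Import Defs.
From Stdlib Require Import PeanoNat Classical FunctionalExtensionality PropExtensionality.

Lemma Pstar_bottom_in {T} (X : oset T) : X None -> Pstar X.
Proof. intros HX _; exact HX. Qed.

Lemma sqle_refl {T} (X : oset T) : sqle X X.
Proof. left; reflexivity. Qed.

Lemma sqle_bottom_free {T} (X Y : oset T) : ~ X None -> sqle X Y -> X = Y.
Proof. intros HX [E | [HX' _]]; [exact E | contradiction]. Qed.

Lemma sqle_returns {T} (X Y : oset T) :
  sqle X Y -> Y None -> forall x, X x -> x <> None -> Y x.
Proof.
  intros [<- | [_ [Hempty | Hsub]]] HY; auto.
  exfalso; exact (Hempty None HY).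
Qed.

Lemma sqle_trans {T} (X Y Z : oset T) : sqle X Y -> sqle Y Z -> sqle X Z.
Proof.
  intros [<- | [HX HXY]] HYZ; [exact HYZ |].
  destruct HYZ as [<- | [HY [HZ | HYZ]]]; right; split; auto.
  right; intros x Hx Hx_ret.
  apply HYZ; auto.
  apply (sqle_returns X Y); auto.
  right; auto.
Qed.

Lemma sqle_antisym {T} (X Y : oset T) : sqle X Y -> sqle Y X -> X = Y.
Proof.
  intros HXY HYX.
  destruct (classic (X None)) as [HX | HX]; [| exact (sqle_bottom_free X Y HX HXY)].
  destruct (classic (Y None)) as [HY | HY]; [| symmetry; exact (sqle_bottom_free Y X HY HYX)].
  apply functional_extensionality; intros [s |]; apply propositional_extensionality.
  - split; intro H; [apply (sqle_returns X Y) | apply (sqle_returns Y X)]; auto; discriminate.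
  - split; auto.
Qed.

Definition bottom_set {T} : oset T := fun x => x = None.

Lemma sqle_bottom_set {T} (X : oset T) : sqle bottom_set X.
Proof.
  right; split; [reflexivity |].
  right; intros x Hx Hx_ret; contradiction.
Qed.

Definition family_union {T I} (c : I -> oset T) : oset T := fun x => exists i, c i x.

Lemma sqle_sup_family_union {T I} (c : I -> oset T) (i0 : I) :
  (forall i, c i None) ->
  (forall i, sqle (c i) (family_union c)) /\
  (forall U, (forall i, sqle (c i) U) -> sqle (family_union c) U).
Proof.
  intros c_diverges; split.
  - intros i; right; split; [exact (c_diverges i) |].
    right; intros x Hx _; exists i; exact Hx.
  - intros U HU; right; split; [exists i0; exact (c_diverges i0) |].
    destruct (classic (exists u, U u)) as [[u Hu] | Hempty];
      [right | left; intros y Hy; exact (Hempty (ex_intro _ y Hy))].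
    intros x [i Hx] Hx_ret.
    destruct (HU i) as [<- | [_ [HUempty | Hsub]]]; auto.
    exfalso; exact (HUempty u Hu).
Qed.

Section Chains.

Variable T : Type.
Variable c : nat -> oset T.
Hypothesis c_incr : forall n, sqle (c n) (c (S n)).

Lemma chain_sqle n m : n <= m -> sqle (c n) (c m).
Proof.
  induction 1; [apply sqle_refl |].
  exact (sqle_trans _ _ _ IHle (c_incr m)).
Qed.

Lemma chain_stationary N : ~ c N None -> forall m, N <= m -> c m = c N.
Proof.
  intros HN; induction 1; [reflexivity |].
  rewrite <- IHle in HN.
  rewrite <- (sqle_bottom_free _ _ HN (c_incr m)); exact IHle.
Qed.

Lemma chain_sup_stationary N : ~ c N None ->
  (forall n, sqle (c n) (c N)) /\
  (forall U, (forall n, sqle (c n) U) -> sqle (c N) U).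
Proof.
  intros HN; split; [| intros U HU; exact (HU N)].
  intros n; destruct (Nat.le_ge_cases n N) as [Hle | Hge].
  - exact (chain_sqle n N Hle).
  - rewrite (chain_stationary N HN n Hge); apply sqle_refl.
Qed.

End Chains.

Theorem proposition4p1 (T : Type) :
  (* reflexivity *)
  (forall X : oset T, Pstar X -> sqle X X) /\
  (* antisymmetry *)
  (forall X Y : oset T, Pstar X -> Pstar Y -> sqle X Y -> sqle Y X -> X = Y) /\
  (* transitivity *)
  (forall X Y Z : oset T, Pstar X -> Pstar Y -> Pstar Z ->
     sqle X Y -> sqle Y Z -> sqle X Z) /\
  (* least element *)
  (exists B : oset T, Pstar B /\ forall X, Pstar X -> sqle B X) /\
  (* every increasing sequence has a supremum *)
  (forall c : nat -> oset T,
     (forall n, Pstar (c n)) -> (forall n, sqle (c n) (c (S n))) ->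
     exists L : oset T, Pstar L /\ (forall n, sqle (c n) L) /\
       (forall U, Pstar U -> (forall n, sqle (c n) U) -> sqle L U)).
Proof.
  split; [intros X _; apply sqle_refl |].
  split; [intros X Y _ _; apply sqle_antisym |].
  split; [intros X Y Z _ _ _; apply sqle_trans |].
  split.
  { exists bottom_set; split; [apply Pstar_bottom_in; reflexivity |].
    intros X _; apply sqle_bottom_set. }
  intros c c_Pstar c_incr.
  destruct (classic (exists N, ~ c N None)) as [[N HN] | Hall].
  - destruct (chain_sup_stationary T c c_incr N HN) as [Hub Hleast].
    exists (c N); split; [apply c_Pstar | split; [exact Hub | auto]].
  - assert (c_diverges : forall n, c n None)
      by (intros n; apply NNPP; intro H; exact (Hall (ex_intro _ n H))).
    destruct (sqle_sup_family_union c 0 c_diverges) as [Hub Hleast].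
    exists (family_union c); split; [apply Pstar_bottom_in; exists 0; apply c_diverges |].
    split; [exact Hub | auto].
Qed.
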